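(* Let $I \subseteq A$ and $J \subseteq B$ be ideals, and let $s\ge 1$ be an integer. Assume that $I^{s-1}\neq I^s$ and $J^{s-1}\neq J^s$. If ${}^{\mathtt a}(I+J)^{(s)} =(I+J)^s$ (as ideals of $R=A\otimes_{\Bbbk}B$), then ${}^{\mathtt a}I^{(i)} =I^i$ and ${}^{\mathtt a}J^{(i)} =J^i$ for all $1\le i \leq s$.
   Context: Throughout, $\Bbbk$ is a field, and $A$ and $B$ are Noetherian commutative $\Bbbk$-algebras such that $R = A\otimes_{\Bbbk} B$ is also Noetherian. $I+J$ means the ideal $IR+JR$ of $R$; the $0$-th power of an ideal is the whole ring. For an ideal $\mathfrak{a}$ of a Noetherian commutative ring $S$, $\operatorname{Ass}_S(\mathfrak{a})$ denotes the set of associated primes of $S/\mathfrak{a}$, and for an integer $s\ge 1$ the $s$-th symbolic power defined by associated primes is ${}^{\mathtt a}\mathfrak{a}^{(s)} = \bigcap_{\mathfrak{p}\in \operatorname{Ass}_S(\mathfrak{a})} (\mathfrak{a}^sS_{\mathfrak{p}}\cap S)$, where $\cap\, S$ means preimage under $S\to S_{\mathfrak{p}}$. *)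

(* Defs.v *)
From HB Require Import structures.
From mathcomp Require Import all_boot all_algebra.
From mathcomp Require Import generic_quotient sesquilinear ring.
From mathcomp Require Import boolp classical_sets.

Set Implicit Arguments.
Unset Strict Implicit.
Unset Printing Implicit Defensive.

Import GRing.Theory.
Local Open Scope ring_scope.
Local Open Scope classical_set_scope.
Local Open Scope quotient_scope.

(* Ideals are arbitrary sets rather than mathcomp's [idealr], which excludes the
   unit ideal; the latter occurs here as the 0-th power. *)
Section Ideals.
Variable S : comNzRingType.
Implicit Types (a b p : set S) (s : nat).

Definition is_ideal a : Prop :=
  [/\ a 0, forall x y, a x -> a y -> a (x + y) & forall r x, a x -> a (r * x)].

Definition is_prime p : Prop :=
  [/\ is_ideal p, ~ p 1 & forall x y, p (x * y) -> p x \/ p y].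

Definition ideal_span (X : set S) : set S := smallest is_ideal X.

Definition ideal_add a b : set S := [set x + y | x in a & y in b].

Definition ideal_mul a b : set S := ideal_span [set x * y | x in a & y in b].

Definition ideal_exp a s : set S := iter s (ideal_mul a) setT.

Definition noetherian : Prop :=
  forall a, is_ideal a -> exists gens : seq S, a = ideal_span [set` gens].

(* The primes that are annihilators of elements of S/a: r kills the class of x
   iff r * x lies in a. *)
Definition Ass a : set (set S) :=
  [set p | is_prime p /\ exists x : S, p = [set r | a (r * x)]].

End Ideals.

Arguments noetherian S : clear implicits.

Definition ideal_ext (S T : comNzRingType) (f : S -> T) (a : set S) : set T :=
  ideal_span (f @` a).

(* The localization S_p; S may have zero divisors, so mathcomp's {fraction S}
   does not apply. *)
Section Localization.
Variables (S : comNzRingType) (p : set S) (p_prime : is_prime p).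

Lemma denom1_proof : 1 \notin p.
Proof. by case: p_prime => _ p1 _; apply/negP; rewrite inE. Qed.

Lemma denomM_proof (u v : {u : S | u \notin p}) : sval u * sval v \notin p.
Proof.
apply/negP; rewrite inE; case: p_prime => _ _ pM.
by case/pM => ?; [case/negP: (valP u) | case/negP: (valP v)]; rewrite inE.
Qed.

(* The proof of primality is an argument of the type so that the ring structure
   below can depend on it. *)
Definition loc_denom of is_prime p : Type := {u : S | u \notin p}.
Local Notation denom := (loc_denom p_prime).
HB.instance Definition _ := SubChoice.on denom.

Definition denom1 : denom := exist _ 1 denom1_proof.
Definition denomM (u v : denom) : denom :=
  exist _ (sval u * sval v) (denomM_proof u v).

Definition prefrac : Type := (S * denom)%type.
HB.instance Definition _ := Choice.on prefrac.
Implicit Types f g h : prefrac.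

Definition frac_equiv : rel prefrac := fun f g =>
  `[< exists u : denom,
        sval u * (f.1 * sval g.2) = sval u * (g.1 * sval f.2) >].

Lemma frac_equiv_refl : reflexive frac_equiv.
Proof. by move=> f; apply/asboolP; exists denom1. Qed.

Lemma frac_equiv_sym : symmetric frac_equiv.
Proof. by move=> f g; apply/asboolP/asboolP => -[u ?]; exists u. Qed.

Lemma frac_equiv_trans : transitive frac_equiv.
Proof.
move=> [b t] [a u] [c w] /asboolP[x /= E1] /asboolP[y /= E2]; apply/asboolP.
exists (denomM (denomM x y) t); rewrite /=.
transitivity (sval y * sval w * (sval x * (a * sval t))); first by ring.
rewrite E1; transitivity (sval x * sval u * (sval y * (b * sval w))); first by ring.
by rewrite E2; ring.
Qed.

Canonical frac_equivRel :=
  EquivRel frac_equiv frac_equiv_refl frac_equiv_sym frac_equiv_trans.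

Definition localization : Type := {eq_quot frac_equiv}.
HB.instance Definition _ : EqQuotient _ frac_equiv localization :=
  EqQuotient.on localization.
HB.instance Definition _ := Choice.on localization.

Definition addf f g : prefrac :=
  (f.1 * sval g.2 + g.1 * sval f.2, denomM f.2 g.2).
Definition oppf f : prefrac := (- f.1, f.2).
Definition mulf f g : prefrac := (f.1 * g.1, denomM f.2 g.2).

Definition loc_of (x : S) : localization :=
  \pi_localization (x, denom1).
Definition loc_add := lift_op2 localization addf.
Definition loc_opp := lift_op1 localization oppf.
Definition loc_mul := lift_op2 localization mulf.

Lemma frac_eqP f g :
  \pi_localization f = \pi_localization g <->
  exists u : denom, sval u * (f.1 * sval g.2) = sval u * (g.1 * sval f.2).
Proof. by split=> [/eqmodP/asboolP | ?]; last apply/eqmodP/asboolP. Qed.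

Lemma repr_frac f : exists u : denom,
  sval u * (f.1 * sval (repr (\pi_localization f)).2) =
  sval u * ((repr (\pi_localization f)).1 * sval f.2).
Proof. by apply/frac_eqP; rewrite reprK. Qed.

Lemma pi_loc_add : {morph \pi : f g / addf f g >-> loc_add f g}.
Proof.
move=> f g; unlock loc_add; apply/frac_eqP.
have [x E1] := repr_frac f; have [y E2] := repr_frac g.
move: (repr _) (repr _) E1 E2 => [d z] [c w]; case: f g => [a t] [b u] /= E1 E2.
exists (denomM x y) => /=.
transitivity (sval y * sval u * sval z * (sval x * (a * sval w)) +
              sval x * sval t * sval w * (sval y * (b * sval z))); first by ring.
by rewrite E1 E2; ring.
Qed.
Canonical pi_loc_add_morph := PiMorph2 pi_loc_add.

Lemma pi_loc_opp : {morph \pi : f / oppf f >-> loc_opp f}.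
Proof.
move=> f; unlock loc_opp; apply/frac_eqP; have [x E] := repr_frac f.
by exists x => /=; rewrite !mulNr !mulrN E.
Qed.
Canonical pi_loc_opp_morph := PiMorph1 pi_loc_opp.

Lemma pi_loc_mul : {morph \pi : f g / mulf f g >-> loc_mul f g}.
Proof.
move=> f g; unlock loc_mul; apply/frac_eqP.
have [x E1] := repr_frac f; have [y E2] := repr_frac g.
move: (repr _) (repr _) E1 E2 => [d z] [c w]; case: f g => [a t] [b u] /= E1 E2.
exists (denomM x y) => /=.
transitivity (sval x * (a * sval w) * (sval y * (b * sval z))); first by ring.
by rewrite E1 E2; ring.
Qed.
Canonical pi_loc_mul_morph := PiMorph2 pi_loc_mul.

Lemma loc_addA : associative loc_add.
Proof.
elim/quotW=> f; elim/quotW=> g; elim/quotW=> h; rewrite !piE.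
by apply/frac_eqP; exists denom1 => /=; ring.
Qed.

Lemma loc_addC : commutative loc_add.
Proof.
elim/quotW=> f; elim/quotW=> g; rewrite !piE.
by apply/frac_eqP; exists denom1 => /=; ring.
Qed.

Lemma loc_add0 : left_id (loc_of 0) loc_add.
Proof.
elim/quotW=> f; rewrite /loc_of !piE.
by apply/frac_eqP; exists denom1 => /=; ring.
Qed.

Lemma loc_addN : left_inverse (loc_of 0) loc_opp loc_add.
Proof.
elim/quotW=> f; rewrite /loc_of !piE.
by apply/frac_eqP; exists denom1 => /=; ring.
Qed.

HB.instance Definition _ :=
  GRing.isZmodule.Build localization loc_addA loc_addC loc_add0 loc_addN.

Lemma loc_mulA : associative loc_mul.
Proof.
elim/quotW=> f; elim/quotW=> g; elim/quotW=> h; rewrite !piE.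
by apply/frac_eqP; exists denom1 => /=; ring.
Qed.

Lemma loc_mulC : commutative loc_mul.
Proof.
elim/quotW=> f; elim/quotW=> g; rewrite !piE.
by apply/frac_eqP; exists denom1 => /=; ring.
Qed.

Lemma loc_mul1 : left_id (loc_of 1) loc_mul.
Proof.
elim/quotW=> f; rewrite /loc_of !piE.
by apply/frac_eqP; exists denom1 => /=; ring.
Qed.

Lemma loc_mulDl : left_distributive loc_mul loc_add.
Proof.
elim/quotW=> f; elim/quotW=> g; elim/quotW=> h; rewrite !piE.
by apply/frac_eqP; exists denom1 => /=; ring.
Qed.

Lemma loc_1neq0 : loc_of 1 != loc_of 0.
Proof.
apply/eqP => /frac_eqP[u] /=; rewrite mul0r !mulr1 mulr0 => u0.
case: p_prime => -[p0 _ _] _ _.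
by have := valP u; rewrite /= u0 notin_setE.
Qed.

HB.instance Definition _ := GRing.Zmodule_isComNzRing.Build localization
  loc_mulA loc_mulC loc_mul1 loc_mulDl loc_1neq0.

Lemma loc_of_is_zmod_morphism : zmod_morphism loc_of.
Proof.
move=> x y; rewrite -[RHS]/(loc_add (loc_of x) (loc_opp (loc_of y))) /loc_of.
by rewrite !piE; apply/frac_eqP; exists denom1 => /=; ring.
Qed.
HB.instance Definition _ :=
  GRing.isZmodMorphism.Build S localization loc_of loc_of_is_zmod_morphism.

Lemma loc_of_is_monoid_morphism : monoid_morphism loc_of.
Proof.
split=> // x y; rewrite -[RHS]/(loc_mul (loc_of x) (loc_of y)) /loc_of.
by rewrite !piE; apply/frac_eqP; exists denom1 => /=; ring.
Qed.
HB.instance Definition _ :=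
  GRing.isMonoidMorphism.Build S localization loc_of loc_of_is_monoid_morphism.

End Localization.

Definition symbolic_power (S : comNzRingType) (a : set S) (s : nat) : set S :=
  [set x | forall (p : set S) (p_prime : is_prime p), Ass a p ->
     ideal_ext (loc_of p_prime) (ideal_exp a s) (loc_of p_prime x)].

(* R, with the maps a |-> a (x) 1 and b |-> 1 (x) b, is the tensor product of
   the K-algebras A and B: the pairing (a, b) |-> iA a * iB b has the universal
   property of A (x)_K B among K-modules.  As iA and iB are morphisms to a
   commutative algebra, the product of R is then the usual one,
   (a (x) b)(a' (x) b') = aa' (x) bb'. *)
Definition is_tensor_product (K : fieldType) (A B R : comAlgType K)
    (iA : {lrmorphism A -> R}) (iB : {lrmorphism B -> R}) : Prop :=
  forall (M : lmodType K) (beta : {bilinear A -> B -> M}),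
    (exists g : {linear R -> M}, forall a b, g (iA a * iB b) = beta a b) /\
    (forall g h : {linear R -> M},
       (forall a b, g (iA a * iB b) = beta a b) ->
       (forall a b, h (iA a * iB b) = beta a b) -> g =1 h).

(* Main.v *)
Require Import Defs.
From HB Require Import structures.
From mathcomp Require Import all_boot all_algebra.
From mathcomp Require Import sesquilinear ring.
From mathcomp Require Import generic_quotient.
From mathcomp Require Import boolp classical_sets.

Set Implicit Arguments.
Unset Strict Implicit.
Unset Printing Implicit Defensive.

Import GRing.Theory.
Local Open Scope ring_scope.
Local Open Scope classical_set_scope.

(** Let [psi] be a K-linear functional on B.  The slice map
    [id (x) psi : A (x) B -> A] sends [a (x) b] to [psi b *: a]; it is A-linear,
    and if [psi] kills an ideal b of B, it maps the ideal [a + b] of R into a,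
    for every ideal a of A ([slice_ext_sum]).  As K is a field, any vector
    outside a subspace is detected by a functional killing the subspace
    ([separating_functional], by Zorn's lemma).  Slice maps replace the freeness
    of A (x) B/J over A in the three steps below.

    - Contraction of associated primes ([Ass_contraction]): if P is an
      associated prime of [I + J], then its contraction p to A is one of I.
      Write P as the annihilator of [z = \sum_k a_k (x) b_k] modulo [I + J].
      Expanding z along elements of B independent modulo J writes p as a finite
      intersection of ideals [(I : c)] with c a slice of z; as p is prime, it
      equals one of them.

    - Hence x (x) y lies in the symbolic power of [I + J] of exponent [i + j]
      whenever x lies in the i-th symbolic power of I and y in [J^j]
      ([symbolic_power_tensor]): an element u outside p with [u x] in [I^i]
      gives [u (x) 1] outside P, and [u x (x) y] lies in [(I + J)^(i + j)].

    - Let x be in the i-th symbolic power of I.  Since the chain of powers of J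
      is still strictly decreasing at [s - i], choose y in [J^(s - i)] outside
      [J^(s - i + 1)].  By the hypothesis on [I + J], the element [x (x) y] lies
      in [(I + J)^s], which is contained in [I^i + J^(s - i + 1)]
      ([ideal_exp_ext_sum_sub]).  Slicing with a functional that kills
      [J^(s - i + 1)] and takes the value 1 at y gives x in [I^i].

    The statement for J follows by exchanging the two tensor factors. *)

(** * Ideals *)

Section IdealTheory.
Variable S : comNzRingType.
Implicit Types (a b p : set S) (x y : S).

Lemma idealB a x y : is_ideal a -> a x -> a y -> a (x - y).
Proof. by case=> _ aD aM ax ay; apply: aD => //; rewrite -mulN1r; apply: aM. Qed.

Lemma ideal_eqT a : is_ideal a -> a 1 -> a = setT.
Proof.
by case=> _ _ aM a1; apply/seteqP; split=> // x _; rewrite -[x]mulr1; apply: aM.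
Qed.

Lemma ideal_setT : is_ideal (setT : set S).
Proof. by []. Qed.

Lemma ideal_spanP (X : set S) : is_ideal (ideal_span X).
Proof.
split=> [a [[]] //|x y sx sy a ha|r x sx a ha]; have [[a0 aD aM] _] := ha.
- by apply: aD; [apply: sx | apply: sy].
- by apply: aM; apply: sx.
Qed.

Lemma ideal_mulP a b : is_ideal (ideal_mul a b).
Proof. exact: ideal_spanP. Qed.

Lemma ideal_expP a n : is_ideal (ideal_exp a n).
Proof. by case: n => [|n]; [exact: ideal_setT | exact: ideal_mulP]. Qed.

Lemma mem_ideal_mul a b x y : a x -> b y -> ideal_mul a b (x * y).
Proof. by move=> ax bY; apply: sub_gen_smallest; exists x => //; exists y. Qed.

Lemma ideal_mul_sub a b c : is_ideal c ->
  (forall x y, a x -> b y -> c (x * y)) -> ideal_mul a b `<=` c.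
Proof. by move=> ci h; apply: smallest_sub => // _ [x ax [y bY <-]]; apply: h. Qed.

(** The ideal quotient (a : x), that is, the annihilator of the class of [x]
    modulo [a]. *)
Definition ideal_colon a x : set S := [set r | a (r * x)].

Lemma ideal_colonP a x : is_ideal a -> is_ideal (ideal_colon a x).
Proof.
case=> a0 aD aM; split; rewrite /ideal_colon /= ?mul0r // => y z.
- by rewrite mulrDl; apply: aD.
- by rewrite -mulrA; apply: aM.
Qed.

Lemma ideal_expS_sub a n : ideal_exp a n.+1 `<=` ideal_exp a n.
Proof.
by apply: ideal_mul_sub; [exact: ideal_expP | move=> x y _; apply (ideal_expP a n)].
Qed.

Lemma ideal_exp_stable a m n : (m <= n)%N ->
  ideal_exp a m = ideal_exp a m.+1 -> ideal_exp a n = ideal_exp a n.+1.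
Proof.
move=> mn E; elim: n mn => [|n IH]; first by rewrite leqn0 => /eqP <-.
by rewrite leq_eqVlt => /predU1P[<- //|/IH En]; congr (ideal_mul a).
Qed.

Lemma mem_ideal_expD a m n x y :
  ideal_exp a m x -> ideal_exp a n y -> ideal_exp a (m + n) (x * y).
Proof.
move=> ax ay; elim: m x ax => [|m IH] x.
  by move=> _; apply (ideal_expP a n).
suff: ideal_exp a m.+1 `<=` ideal_colon (ideal_exp a (m.+1 + n)) y by apply.
apply: ideal_mul_sub; first exact/ideal_colonP/ideal_expP.
move=> u v au av; rewrite /ideal_colon /= -mulrA.
by apply: mem_ideal_mul => //; apply: IH.
Qed.

Lemma prime_setI p a b : is_prime p -> is_ideal a -> is_ideal b ->
  p = a `&` b -> p = a \/ p = b.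
Proof.
move=> [pid _ pM] ai bi pE.
have [pa|/existsNP[x /not_implyP[ax npx]]] := pselect (a `<=` p).
  by left; apply/seteqP; split=> //; rewrite pE => x [].
right; apply/seteqP; split; first by rewrite pE => y [].
move=> y bY; have : p (x * y).
  rewrite pE; split; last by case: bi => _ _; apply.
  by rewrite mulrC; case: ai => _ _; apply.
by case/pM.
Qed.

Lemma ideal_addP a b : is_ideal a -> is_ideal b -> is_ideal (ideal_add a b).
Proof.
move=> [a0 aD aM] [b0 bD bM]; split.
- by exists 0 => //; exists 0 => //; rewrite addr0.
- move=> _ _ [x ax [y bY <-]] [u au [v bv <-]].
  by exists (x + u); [exact: aD|exists (y + v); [exact: bD|rewrite addrACA]].
- move=> r _ [x ax [y bY <-]].
  by exists (r * x); [exact: aM|exists (r * y); [exact: bM|rewrite mulrDr]].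
Qed.

Lemma ideal_addC a b : ideal_add a b = ideal_add b a.
Proof.
apply/seteqP; split=> _ [x ax [y bY <-]];
  by exists y => //; exists x; rewrite // addrC.
Qed.

Lemma sub_ideal_addl a b : is_ideal b -> a `<=` ideal_add a b.
Proof. by case=> b0 _ _ x ax; exists x => //; exists 0; rewrite ?addr0. Qed.

Lemma sub_ideal_addr a b : is_ideal a -> b `<=` ideal_add a b.
Proof. by rewrite ideal_addC; apply: sub_ideal_addl. Qed.

Lemma ideal_add_sub a b c : is_ideal c -> a `<=` c -> b `<=` c ->
  ideal_add a b `<=` c.
Proof. by case=> _ cD _ ac bc _ [x /ac cx [y /bc cy <-]]; apply: cD. Qed.

End IdealTheory.

(** * Extension and contraction along a ring morphism *)

Section IdealExtension.
Variables (S T : comNzRingType) (f : {rmorphism S -> T}).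
Implicit Types (a b : set S) (c p : set T).

Lemma ideal_extP a : is_ideal (ideal_ext f a).
Proof. exact: ideal_spanP. Qed.

Lemma mem_ideal_ext a x : a x -> ideal_ext f a (f x).
Proof. by move=> ax; apply: sub_gen_smallest; exists x. Qed.

Lemma ideal_ext_sub a c : is_ideal c -> (forall x, a x -> c (f x)) ->
  ideal_ext f a `<=` c.
Proof. by move=> ci h; apply: smallest_sub => // _ [x ax <-]; apply: h. Qed.

Lemma ideal_preimage c : is_ideal c -> is_ideal (f @^-1` c).
Proof.
case=> c0 cD cM; split; rewrite /preimage /= ?rmorph0 // => x y.
- by rewrite rmorphD; apply: cD.
- by rewrite rmorphM; apply: cM.
Qed.

Lemma prime_preimage p : is_prime p -> is_prime (f @^-1` p).
Proof.
case=> pid p1 pM; split; first exact: ideal_preimage.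
- by rewrite /preimage /= rmorph1.
- by move=> x y; rewrite /preimage /= rmorphM; apply: pM.
Qed.

Lemma ideal_exp_preimage a c n : (forall x, a x -> c (f x)) ->
  forall x, ideal_exp a n x -> ideal_exp c n (f x).
Proof.
move=> ac; elim: n => [//|n IH].
suff: ideal_exp a n.+1 `<=` f @^-1` ideal_exp c n.+1 by [].
apply: ideal_mul_sub; first exact/ideal_preimage/ideal_expP.
move=> x y ax ay; rewrite /preimage /= rmorphM.
by apply: mem_ideal_mul; [apply: ac | apply: IH].
Qed.

Lemma ideal_ext_mul a b x y : ideal_ext f a x -> ideal_ext f b y ->
  ideal_ext f (ideal_mul a b) (x * y).
Proof.
move=> ax bY; have ei := ideal_extP (ideal_mul a b).
have: ideal_ext f a `<=` ideal_colon (ideal_ext f (ideal_mul a b)) y.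
  apply: ideal_ext_sub; first exact: ideal_colonP.
  move=> u au; rewrite /ideal_colon /= mulrC.
  have: ideal_ext f b `<=` ideal_colon (ideal_ext f (ideal_mul a b)) (f u).
    apply: ideal_ext_sub; first exact: ideal_colonP.
    move=> v bv; rewrite /ideal_colon /= mulrC -rmorphM.
    by apply: mem_ideal_ext; apply: mem_ideal_mul.
  by apply.
by apply.
Qed.

End IdealExtension.

(** * Symbolic powers without localizations *)

Section SymbolicPowers.
Local Open Scope quotient_scope.
Variable S : comNzRingType.
Implicit Types (a p : set S) (x : S).

(** The preimage in S of the extension of [a] to the localization at [p]. *)
Lemma ideal_ext_locP a p (pp : is_prime p) x : is_ideal a ->
  ideal_ext (loc_of pp) a (loc_of pp x) <-> exists2 u, ~ p u & a (u * x).
Proof.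
move=> ai; have [a0 aD aM] := ai; have [pid p1 pM] := pp; split; last first.
  move=> [u pu aux]; have up : u \notin p by rewrite notin_setE.
  pose w : loc_denom pp := exist _ u up.
  have -> : loc_of pp x = \pi_(localization pp) (1, w) * loc_of pp (u * x).
    rewrite -[RHS]/(loc_mul _ _) /loc_of !piE; apply/frac_eqP.
    by exists (denom1 pp) => /=; ring.
  by apply (ideal_extP (loc_of pp) a); apply: mem_ideal_ext.
(* The fractions with some numerator in [a] form an ideal. *)
pose N : set (localization pp) :=
  [set f | exists u y, [/\ ~ p u, a y & f * loc_of pp u = loc_of pp y]].
have NI : is_ideal N.
  split.
  - by exists 1, 0; split=> //; rewrite mul0r rmorph0.
  - move=> f g [u [y [pu ay fE]]] [v [z [pv az gE]]].
    exists (u * v), (y * v + z * u); split; first by case/pM.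
      by apply: aD; rewrite mulrC; apply: aM.
    by rewrite !(rmorphD, rmorphM) /= -fE -gE; ring.
  - elim/quotW=> -[b t] f [u [y [pu ay fE]]]; exists (sval t * u), (b * y); split.
    + by case/pM => //; have := valP t; rewrite /= notin_setE.
    + exact: aM.
    have bE : \pi_(localization pp) (b, t) * loc_of pp (sval t) = loc_of pp b.
      rewrite -[LHS]/(loc_mul _ _) /loc_of !piE; apply/frac_eqP.
      by exists (denom1 pp) => /=; ring.
    by rewrite !rmorphM /= -fE -bE; ring.
have /[apply] : ideal_ext (loc_of pp) a `<=` N.
  apply: ideal_ext_sub => // y ay; exists 1, y; split=> //.
  by rewrite rmorph1 mulr1.
move=> [u [y [pu ay]]]; rewrite -rmorphM => /frac_eqP[[v vp]] /= E.
exists (v * u); last first.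
  suff -> : v * u * x = v * y by apply: aM.
  by move: E; rewrite !mulr1 => <-; ring.
by case/pM => //; move: vp; rewrite notin_setE.
Qed.

Lemma symbolic_powerP a n x :
  symbolic_power a n x <-> forall p, is_prime p -> Ass a p ->
    exists2 u, ~ p u & ideal_exp a n (u * x).
Proof.
split=> h p pp ap; first by apply/(ideal_ext_locP pp); [exact: ideal_expP | apply: h].
by apply/(ideal_ext_locP pp); [exact: ideal_expP | apply: h].
Qed.

Lemma sub_symbolic_power a n : ideal_exp a n `<=` symbolic_power a n.
Proof.
move=> x ax; apply/symbolic_powerP => p [_ p1 _] _.
by exists 1; rewrite ?mul1r.
Qed.

End SymbolicPowers.

(** * Linear functionals over a field *)

Section Functionals.
Variables (K : fieldType) (V : lmodType K).
Implicit Types (U W X : set V).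

(** K-linear subspaces, as sets of vectors. *)
Definition is_subspace W : Prop :=
  [/\ W 0, forall x y, W x -> W y -> W (x + y) & forall c x, W x -> W (c *: x)].

Lemma subspaceB W x y : is_subspace W -> W x -> W y -> W (x - y).
Proof. by case=> _ WD WZ Wx Wy; apply: WD => //; rewrite -scaleN1r; apply: WZ. Qed.

Lemma maximal_subspace_avoiding W v : is_subspace W -> ~ W v ->
  exists U, [/\ is_subspace U, W `<=` U, ~ U v &
    forall U', is_subspace U' -> U `<=` U' -> ~ U' v -> U' `<=` U].
Proof.
move=> Ws Wv; pose P := [set X | is_subspace (W `|` X) /\ ~ (W `|` X) v].
(* Zorn's lemma is applied to the sets X such that W `|` X is a subspace
   avoiding v, rather than to the subspaces containing W: this way the union of
   the empty chain also qualifies. *)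
have [F FP Ftot|X [[Xs Xv] Xmax]] := @Zorn_bigcup V P.
  have [W0 WD WZ] := Ws; split; last first.
    by case=> // -[X FX Xv]; have [_] := FP _ FX; apply; right.
  have FU X x : F X -> (W `|` X) x -> (W `|` \bigcup_(X in F) X) x.
    by move=> FX [Wx|Xx]; [left|right; exists X].
  split; first by left.
  - move=> x y [Wx|[X FX Xx]] [Wy|[Y FY Yy]].
    + by left; apply: WD.
    + by apply: (FU Y) => //; case: (FP _ FY) => -[_ D _] _; apply: D; [left|right].
    + by apply: (FU X) => //; case: (FP _ FX) => -[_ D _] _; apply: D; [right|left].
    + have [XY|YX] := Ftot _ _ FX FY.
        apply: (FU Y) => //; case: (FP _ FY) => -[_ D _] _.
        by apply: D; right => //; apply: XY.
      apply: (FU X) => //; case: (FP _ FX) => -[_ D _] _.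
      by apply: D; right => //; apply: YX.
  - move=> c x [Wx|[X FX Xx]]; first by left; apply: WZ.
    by apply: (FU X) => //; case: (FP _ FX) => -[_ _ Z] _; apply: Z; right.
exists (W `|` X); split=> // U' U's UU' U'v; apply: contrapT => nsub.
have WU' : W `|` U' = U' by apply/setUidPr => x Wx; apply: UU'; left.
apply: (Xmax U'); last by split; rewrite WU'.
split; first by move=> x Xx; apply: UU'; right.
by move=> U'X; apply: nsub => x /U'X; right.
Qed.

(** A subspace U containing W and maximal among those avoiding [v] is a
    hyperplane complementary to the line of [v]; the functional is the
    coordinate along [v]. *)
Lemma separating_functional W v : is_subspace W -> ~ W v ->
  exists f : {linear V -> K^o}, (forall w, W w -> f w = 0) /\ f v = 1.
Proof.
move=> Ws Wv; have [U [Us WU Uv Umax]] := maximal_subspace_avoiding Ws Wv.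
have [U0 UD UZ] := Us.
have ex x : exists c : K, U (x - c *: v).
  have [Ux|Ux] := pselect (U x); first by exists 0; rewrite scale0r subr0.
  pose U' : set V := [set z | exists u c, U u /\ z = u + c *: x].
  have U's : is_subspace U'.
    split.
    - by exists 0, 0; rewrite scale0r addr0.
    - move=> _ _ [u [c [Uu ->]]] [w [d [Uw ->]]].
      by exists (u + w), (c + d); split; [exact: UD | rewrite scalerDl addrACA].
    - move=> d _ [u [c [Uu ->]]]; exists (d *: u), (d * c).
      by split; [exact: UZ | rewrite scalerDr scalerA].
  have UU' : U `<=` U' by move=> u Uu; exists u, 0; rewrite scale0r addr0.
  have [[u [c [Uu vE]]]|U'v] := pselect (U' v); last first.
    by case: Ux; apply: (Umax U') => //; exists 0, 1; rewrite scale1r add0r.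
  have c0 : c != 0 by apply/eqP => c0; apply: Uv; rewrite vE c0 scale0r addr0.
  exists c^-1; rewrite vE scalerDr scalerA mulVf // scale1r.
  by rewrite opprD addrCA subrr addr0 -scaleNr; apply: UZ.
have uniq x c d : U (x - c *: v) -> U (x - d *: v) -> c = d.
  move=> Uc Ud; apply/eqP; rewrite -subr_eq0; apply/eqP; apply: contrapT => /eqP cd.
  apply: Uv; have Udiff : U ((c - d) *: v).
    have -> : (c - d) *: v = x - d *: v - (x - c *: v).
      by rewrite scalerBl opprB [RHS]addrC subrKA.
    exact: subspaceB.
  by rewrite -[v]scale1r -(mulVf cd) -scalerA; apply: UZ.
have [f fP] := choice ex.
have flin : linear (f : V -> K^o).
  move=> c x y; apply: (uniq (c *: x + y)) => //.
  rewrite scalerDl -scalerA opprD addrACA -scalerBr.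
  by apply: UD => //; apply: UZ.
pose g : {linear V -> K^o} := HB.pack (f : V -> K^o)
  (GRing.isLinear.Build K V K^o *:%R (f : V -> K^o) flin).
exists g; split=> [w Ww|] /=.
- by apply: (uniq w) => //; rewrite scale0r subr0; apply: WU.
- by apply: (uniq v) => //; rewrite scale1r subrr.
Qed.

End Functionals.

Lemma ideal_subspace (K : fieldType) (A : comAlgType K) (a : set A) :
  is_ideal a -> is_subspace a.
Proof. by case=> a0 aD aM; split=> // c x; rewrite -mulr_algl; apply: aM. Qed.

(** * Slice maps and associated primes of a tensor product *)

Section TensorProduct.
Variables (K : fieldType) (A B R : comAlgType K).
Variables (iA : {lrmorphism A -> R}) (iB : {lrmorphism B -> R}).
Hypothesis tensorR : is_tensor_product iA iB.
Variables (I : set A) (J : set B).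
Hypotheses (idealI : is_ideal I) (idealJ : is_ideal J).

(* The ideal aR + bR of R, for an ideal [a] of A and an ideal [b] of B. *)
Local Notation ext_sum a b := (ideal_add (ideal_ext iA a) (ideal_ext iB b)).

Lemma ext_sumP a b : is_ideal (ext_sum a b).
Proof. by apply: ideal_addP; exact: ideal_extP. Qed.

Lemma mem_ext_suml a b x : a x -> ext_sum a b (iA x).
Proof.
by move=> ax; apply: sub_ideal_addl; [exact: ideal_extP | exact: mem_ideal_ext].
Qed.

Lemma mem_ext_sumr a b y : b y -> ext_sum a b (iB y).
Proof.
by move=> bY; apply: sub_ideal_addr; [exact: ideal_extP | exact: mem_ideal_ext].
Qed.

(** Otherwise some nonzero functional on R vanishes on the pure tensors, against
    the uniqueness clause of the universal property. *)
Lemma pure_tensors_span (r : R) :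
  exists l : seq (A * B), r = \sum_(t <- l) iA t.1 * iB t.2.
Proof.
pose W : set R :=
  [set r | exists l : seq (A * B), r = \sum_(t <- l) iA t.1 * iB t.2].
have Ws : is_subspace W.
  split; first by exists [::]; rewrite big_nil.
  - by move=> _ _ [l ->] [m ->]; exists (l ++ m); rewrite big_cat.
  - move=> c _ [l ->]; exists [seq (c *: t.1, t.2) | t <- l].
    rewrite big_map scaler_sumr; apply: eq_bigr => t _ /=.
    by rewrite linearZ scalerAl.
apply: contrapT => Wr; have [f [fW fr]] := separating_functional Ws Wr.
have bil0 : bilinear_for *:%R *:%R ((fun _ _ => 0) : A -> B -> K^o).
  by split=> ? ? ? ? /=; rewrite scaler0 addr0.
pose beta : {bilinear A -> B -> K^o} := HB.pack ((fun _ _ => 0) : A -> B -> K^o)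
  (bilinear_isBilinear.Build K A B K^o *:%R *:%R _ bil0).
have [_ uniq] := tensorR beta.
have /eqP : f r = 0.
  apply: (uniq f \0) => // a b; apply: fW.
  by exists [:: (a, b)]; rewrite big_seq1.
by rewrite fr oner_eq0.
Qed.

(** The map id (x) psi. *)
Lemma slice_map (psi : {linear B -> K^o}) : exists g : {linear R -> A},
  (forall a b, g (iA a * iB b) = (psi b : K) *: a) /\
  (forall a r, g (iA a * r) = a * g r).
Proof.
have bil : bilinear_for *:%R *:%R ((fun a b => (psi b : K) *: a) : A -> B -> A).
  split=> [b c x y|a c x y] /=; first by rewrite scalerDr !scalerA mulrC.
  by rewrite linearP scalerDl scalerA.
pose beta : {bilinear A -> B -> A} := HB.pack
  ((fun a b => (psi b : K) *: a) : A -> B -> A)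
  (bilinear_isBilinear.Build K A B A *:%R *:%R _ bil).
have [[g gE] _] := tensorR beta; exists g; split=> // a r.
have [l ->] := pure_tensors_span r.
rewrite mulr_sumr !linear_sum mulr_sumr; apply: eq_bigr => t _.
by rewrite mulrA -rmorphM !gE /= scalerAr.
Qed.

Lemma slice_ext_sum (psi : {linear B -> K^o}) (g : {linear R -> A})
    (a : set A) (b : set B) :
  is_ideal a -> is_ideal b ->
  (forall x y, g (iA x * iB y) = (psi y : K) *: x) ->
  (forall x r, g (iA x * r) = x * g r) ->
  (forall y, b y -> psi y = 0) ->
  forall r, ext_sum a b r -> a (g r).
Proof.
move=> ai bi gE gM psib.
have [a0 aD aM] := ai; have [_ _ bM] := bi.
pose c : set R := [set r | forall t, a (g (t * r))].
have ci : is_ideal c.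
  split=> [t|x y cx cy t|s x cx t]; first by rewrite mulr0 linear0.
  - by rewrite mulrDr linearD; apply: aD.
  - by rewrite mulrA.
have ec : ext_sum a b `<=` c.
  apply: ideal_add_sub => //; apply: ideal_ext_sub => // x xI t.
    by rewrite mulrC gM mulrC; apply: aM.
  have [l ->] := pure_tensors_span t.
  rewrite mulr_suml linear_sum big1 // => u _.
  by rewrite -mulrA -rmorphM gE psib ?scale0r //; apply: bM.
by move=> r /ec/(_ 1); rewrite mul1r.
Qed.

(** The contraction of a prime annihilator (I + J : z), where z is a sum of pure
    tensors.  By induction on the number of terms: the first term [a (x) b] is
    dropped if [b] is in J; otherwise a functional killing J with value 1 at [b]
    splits z as [c (x) b + z'], where c is the slice of z and z' has fewer terms,
    and the contraction is the intersection of (I : c) with that of z'. *)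
Lemma prime_colon_contraction (l : seq (A * B)) (p : set A) : is_prime p ->
  p = [set a | ext_sum I J (iA a * \sum_(t <- l) iA t.1 * iB t.2)] ->
  exists x, p = [set r | I (r * x)].
Proof.
elim: {l}(size l) {-2}l (leqnn (size l)) => [|n IH] l ln pp pE.
  case: l ln pE => // _ pE; case: pp => _ p1 _; case: p1.
  rewrite pE /= big_nil mulr0.
  by case: (ext_sumP I J).
case: l ln pE => [|[a b] l] /= ln pE; first exact: (IH [::]).
have eP := ext_sumP I J; have [e0 eD eM] := eP.
have [Jb|Jb] := pselect (J b).
  apply: (IH l) => //; rewrite pE.
  apply/seteqP; split=> r /=; rewrite big_cons mulrDr /=.
  - move=> h; rewrite -[X in ext_sum I J X](addKr (iA r * (iA a * iB b))).
    rewrite addrC; apply: idealB => //.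
    exact/eM/eM/mem_ext_sumr.
  - move=> h; apply: eD => //.
    exact/eM/eM/mem_ext_sumr.
have [psi [psiJ psib]] := separating_functional (ideal_subspace idealJ) Jb.
have [g [gE gM]] := slice_map psi.
(* Subtracting psi t.2 *: b from each t.2 moves the whole slice of z to b. *)
pose l' := [seq (t.1, t.2 - (psi t.2 : K) *: b) | t <- l].
pose z := \sum_(t <- (a, b) :: l) iA t.1 * iB t.2.
pose z' := \sum_(t <- l') iA t.1 * iB t.2.
have zE : z = iA (g z) * iB b + z'.
  rewrite /z /z' big_map big_cons /= linearD gE psib scale1r.
  rewrite rmorphD mulrDl -addrA; congr (_ + _).
  rewrite linear_sum rmorph_sum mulr_suml -big_split /=; apply: eq_bigr => t _.
  rewrite gE rmorphB mulrBr /= !linearZ /= -scalerAl -scalerAr.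
  by rewrite addrC subrK.
have z'E : z' = z - iA (g z) * iB b by rewrite {1}zE addrAC subrr add0r.
have pE' : p = ideal_colon I (g z) `&` [set r | ext_sum I J (iA r * z')].
  rewrite pE -/z; apply/seteqP; split=> r /=.
  - move=> h; have Irz : I (r * g z).
      by rewrite -gM; apply: (slice_ext_sum idealI idealJ gE gM psiJ).
    split=> //; have -> : iA r * z' = iA r * z - iB b * iA (r * g z).
      by rewrite z'E rmorphM; ring.
    by apply: idealB => //; apply: eM; apply: mem_ext_suml.
  - case=> Irz h; have -> : iA r * z = iB b * iA (r * g z) + iA r * z'.
      by rewrite z'E rmorphM; ring.
    by apply: eD => //; apply: eM; apply: mem_ext_suml.
have ci : is_ideal [set r | ext_sum I J (iA r * z')].
  exact: (ideal_preimage _ (ideal_colonP z' eP)).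
have [->|pz'] := prime_setI pp (ideal_colonP (g z) idealI) ci pE'.
  by exists (g z).
by apply: (IH l') => //; rewrite size_map.
Qed.

Lemma Ass_contraction (P : set R) : Ass (ext_sum I J) P -> Ass I (iA @^-1` P).
Proof.
move=> [Pp [z PE]]; split; first exact: prime_preimage.
have [l zE] := pure_tensors_span z.
apply: (prime_colon_contraction (l := l)); first exact: prime_preimage.
by rewrite -zE {1}PE.
Qed.

Lemma symbolic_power_tensor i j (x : A) (y : B) :
  symbolic_power I i x -> ideal_exp J j y ->
  symbolic_power (ext_sum I J) (i + j) (iA x * iB y).
Proof.
move=> /symbolic_powerP Ix Jy; apply/symbolic_powerP => P Pp PA.
have [u pu Iux] := Ix _ (prime_preimage _ Pp) (Ass_contraction PA).
exists (iA u) => //; rewrite mulrA -rmorphM; apply: mem_ideal_expD.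
- by apply: ideal_exp_preimage Iux => a; apply: mem_ext_suml.
- by apply: ideal_exp_preimage Jy => b; apply: mem_ext_sumr.
Qed.

Lemma ideal_exp_ext_sum_sub n i j : (i + j <= n.+1)%N ->
  ideal_exp (ext_sum I J) n `<=` ext_sum (ideal_exp I i) (ideal_exp J j).
Proof.
have triv k l : (k == 0%N) || (l == 0%N) ->
    ext_sum (ideal_exp I k) (ideal_exp J l) = setT.
  move=> kl0; apply: ideal_eqT; first exact: ext_sumP.
  case/orP: kl0 => /eqP ->; first by rewrite -(rmorph1 iA); apply: mem_ext_suml.
  by rewrite -(rmorph1 iB); apply: mem_ext_sumr.
elim: n i j => [|n IH] [|i] [|j] ij; try by rewrite triv.
  by rewrite addSn addnS in ij.
have cP : is_ideal (ext_sum (ideal_exp I i.+1) (ideal_exp J j.+1)).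
  exact: ext_sumP.
have [_ cD cM] := cP.
apply: ideal_mul_sub => // _ w [x xI [y yJ <-]] wE; rewrite mulrDl; apply: (cD).
- have [|v vI [t tJ <-]] := IH i j.+1 _ w wE; first by rewrite addSn in ij.
  rewrite mulrDr; apply: cD.
    by apply: sub_ideal_addl; [exact: ideal_extP | exact: ideal_ext_mul].
  by apply: cM; apply: sub_ideal_addr => //; exact: ideal_extP.
- have [|v vI [t tJ <-]] := IH i.+1 j _ w wE; first by rewrite addnS in ij.
  rewrite mulrDr; apply: cD.
    by apply: cM; apply: sub_ideal_addl => //; exact: ideal_extP.
  by apply: sub_ideal_addr; [exact: ideal_extP | exact: ideal_ext_mul].
Qed.

(** The conclusion for the left factor; of the two conditions that consecutive
    powers differ, it needs only the one on J. *)
Lemma symbolic_power_left s i : (1 <= i <= s)%N ->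
  ideal_exp J (s - 1) <> ideal_exp J s ->
  symbolic_power (ext_sum I J) s = ideal_exp (ext_sum I J) s ->
  symbolic_power I i = ideal_exp I i.
Proof.
move=> /andP[i_ge1 le_is] Jneq symb.
apply/seteqP; split; last exact: sub_symbolic_power.
move=> x Ix.
have [y Jy Jy'] : exists2 y, ideal_exp J (s - i) y & ~ ideal_exp J (s - i).+1 y.
  (* Two equal consecutive powers make all later powers equal. *)
  apply: contrapT => h; apply: Jneq.
  have s1 : (s - 1).+1 = s by rewrite subn1 prednK // (leq_trans i_ge1 le_is).
  rewrite -[in RHS]s1.
  apply: (@ideal_exp_stable _ _ (s - i)); first exact: leq_sub2l.
  apply/seteqP; split; last exact: ideal_expS_sub.
  by move=> y Jy; apply: contrapT => Jy'; apply: h; exists y.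
have [psi [psiJ psiy]] :=
  separating_functional (ideal_subspace (ideal_expP J (s - i).+1)) Jy'.
have [g [gE gM]] := slice_map psi.
have -> : x = g (iA x * iB y) by rewrite gE psiy scale1r.
apply: (slice_ext_sum (ideal_expP I i) (ideal_expP J (s - i).+1) gE gM psiJ).
apply: (@ideal_exp_ext_sum_sub s); first by rewrite addnS subnKC.
by rewrite -symb -[in symbolic_power _ s](subnKC le_is); apply: symbolic_power_tensor.
Qed.

End TensorProduct.

Lemma tensor_product_sym (K : fieldType) (A B R : comAlgType K)
    (iA : {lrmorphism A -> R}) (iB : {lrmorphism B -> R}) :
  is_tensor_product iA iB -> is_tensor_product iB iA.
Proof.
move=> tens M beta.
have bil : bilinear_for *:%R *:%R ((fun a b => beta b a) : A -> B -> M).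
  by split=> ? ? ? ? /=; rewrite ?linearPl ?linearPr.
pose gamma : {bilinear A -> B -> M} := HB.pack ((fun a b => beta b a) : A -> B -> M)
  (bilinear_isBilinear.Build K A B M *:%R *:%R _ bil).
have [[g gE] uniq] := tens M gamma; split.
  by exists g => b a; rewrite mulrC gE.
by move=> h k hE kE; apply: uniq => a b; rewrite mulrC; [apply: hE | apply: kE].
Qed.

Theorem corollary4p2 (K : fieldType) (A B R : comAlgType K)
    (iA : {lrmorphism A -> R}) (iB : {lrmorphism B -> R})
    (tensorR : is_tensor_product iA iB)
    (noethA : noetherian A) (noethB : noetherian B) (noethR : noetherian R)
    (I : set A) (J : set B) (idealI : is_ideal I) (idealJ : is_ideal J)
    (s : nat) (s_ge1 : (1 <= s)%N)
    (I_neq : ideal_exp I (s - 1) <> ideal_exp I s)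
    (J_neq : ideal_exp J (s - 1) <> ideal_exp J s)
    (symb_sum :
       symbolic_power (ideal_add (ideal_ext iA I) (ideal_ext iB J)) s =
       ideal_exp (ideal_add (ideal_ext iA I) (ideal_ext iB J)) s) :
  forall i : nat, (1 <= i <= s)%N ->
    symbolic_power I i = ideal_exp I i /\ symbolic_power J i = ideal_exp J i.
Proof.
move=> i le_is; split; first exact: (symbolic_power_left tensorR idealI idealJ le_is).
rewrite ideal_addC in symb_sum.
exact: (symbolic_power_left (tensor_product_sym tensorR) idealJ idealI le_is).
Qed.
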